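(* Let $U=M_\xi$ be multiplication by the independent variable on the direct integral $\mathcal H\subset L^2(\mu;E)$, let $\mathbf B:\mathbb C^d\to\mathcal H$ be an isometry whose range is star-cyclic for $U$, and let $\theta=\theta_{\mathbf 0}$ be the characteristic function of $T_{\mathbf 0}=U-\mathbf B\mathbf B^*U$ with coordinate operators $V=\mathbf B^*U$, $V_*=\mathbf B^*$. Suppose that $\theta$ is inner, so that $\mathcal K_\theta=H^2(\mathbb C^d)\ominus\theta H^2(\mathbb C^d)$, and let $\Phi:\mathcal K_\theta\to\mathcal H$ be the Clark operator for $T_{\mathbf 0}$ (see context). Then for all $f\in\mathcal H$ and $z\in\mathbb D$ $$(\Phi^*f)(z)=(\mathbf I-\theta(z))\int_{\mathbb T}\frac{B^*(\xi)f(\xi)}{1-\bar\xi z}\,d\mu(\xi)=F(z)^{-1}\int_{\mathbb T}\frac{B^*(\xi)f(\xi)}{1-\bar\xi z}\,d\mu(\xi).$$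
   Context: Direct integral: $\mu$ is a finite positive Borel measure on the unit circle $\mathbb T$; $E$ is a separable Hilbert space with orthonormal basis $(\varepsilon_n)_{n\ge1}$; $N:\mathbb T\to\mathbb N\cup\{\infty\}$ is measurable; $E(\xi)=\overline{\operatorname{span}}\{\varepsilon_n:1\le n\le N(\xi)\}$; $\mathcal H=\{f\in L^2(\mu;E): f(\xi)\in E(\xi)\ \mu\text{-a.e.}\}$. $e_1,\dots,e_d$ is the standard basis of $\mathbb C^d$, $b_k=\mathbf Be_k$, $B(\xi)=(b_1(\xi),\dots,b_d(\xi)):\mathbb C^d\to E(\xi)$, $B^*(\xi)=B(\xi)^*$. A subspace $\mathfrak R$ is star-cyclic for $U$ if $\overline{\operatorname{span}}\{U^k\mathfrak R:k\in\mathbb Z\}=\mathcal H$. For a contraction $A$: $D_A=(\mathbf I-A^*A)^{1/2}$. The characteristic function of $T=T_{\mathbf 0}$ is $\theta_{\mathbf 0}(z)=\mathbf B^*\bigl(-T+zD_{T^*}(\mathbf I-zT^* )^{-1}D_T\bigr)U^*\mathbf B$, $z\in\mathbb D$; one has $\theta_{\mathbf 0}(0)=0$. Inner means that the boundary values $\theta(\xi)$ are isometries (hence unitary $d\times d$ matrices) for Lebesgue a.e. $\xi\in\mathbb T$. The model operator is $\mathcal M_\theta=P_{\mathcal K_\theta}M_z|_{\mathcal K_\theta}$. Clark operator: the unitary operator $\Phi:\mathcal K_\theta\to\mathcal H$ with $\Phi\mathcal M_\theta=T_{\mathbf 0}\Phi$, $(\Phi^*\mathbf Be)(z)=e$ and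 $(\Phi^*U^*\mathbf Be)(z)=z^{-1}\theta(z)e$ for all $e\in\mathbb C^d$. $F(z)=\int_{\mathbb T}\frac{1}{1-z\bar\xi}B^*(\xi)B(\xi)\,d\mu(\xi)$, $z\in\mathbb D$. *)

(* Defs.v *)
From HB Require Import structures.
From mathcomp Require Import all_boot all_order all_algebra.
From mathcomp Require Import complex ring lra.
From mathcomp Require Import all_classical all_reals all_analysis measurable_realfun.

Set Implicit Arguments.
Unset Strict Implicit.
Unset Printing Implicit Defensive.

Import Order.TTheory GRing.Theory Num.Theory.
Import numFieldNormedType.Exports.

Local Open Scope classical_set_scope.
Local Open Scope complex_scope.
Local Open Scope ring_scope.

Local Notation Re := (@complex.Re _).
Local Notation Im := (@complex.Im _).

(* Inner products are linear in the first argument. *)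
HB.mixin Record Lmodule_isInner (R : realType) V of GRing.Lmodule R[i] V := {
  inner : V -> V -> R[i];
  inner_linearl : forall (a : R[i]) (x x' y : V),
    inner (a *: x + x') y = a * inner x y + inner x' y;
  innerC : forall x y : V, inner x y = (inner y x)^*%C;
  inner_gt0 : forall x : V, x != 0 -> 0 < inner x x }.

#[short(type="innerType")]
HB.structure Definition Inner (R : realType) :=
  {V of GRing.Lmodule R[i] V & Lmodule_isInner R V}.

HB.mixin Record NormedInner_isHilbert (R : realType) V
    of NormedModule R[i] V & Inner R V := {
  inner_norm : forall x : V, inner x x = `|x| ^+ 2 }.

#[short(type="hilbertType")]
HB.structure Definition Hilbert (R : realType) :=
  {V of CompleteNormedModule R[i] V & Inner R V & NormedInner_isHilbert R V}.

Section InnerTheory.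
Variables (R : realType) (V : innerType R).
Implicit Types (x y z : V) (a : R[i]).

Definition hnorm x : R := Num.sqrt (Re (inner x x)).

Local Notation nsq x := (Re (inner x x)).

Lemma innerDl x x' y : inner (x + x') y = inner x y + inner x' y.
Proof. by rewrite -[x]scale1r inner_linearl scale1r mul1r. Qed.

Lemma inner0l y : inner 0 y = 0.
Proof. by apply: (addrI (inner 0 y)); rewrite -innerDl !addr0. Qed.

Lemma innerZl a x y : inner (a *: x) y = a * inner x y.
Proof. by rewrite -[a *: x]addr0 inner_linearl inner0l addr0. Qed.

Lemma innerDr x y y' : inner x (y + y') = inner x y + inner x y'.
Proof. by rewrite innerC innerDl rmorphD/= -!innerC. Qed.

Lemma innerZr a x y : inner x (a *: y) = a^*%C * inner x y.
Proof. by rewrite innerC innerZl rmorphM/= -innerC. Qed.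

Lemma inner0r x : inner x 0 = 0.
Proof. by rewrite innerC inner0l conjc0. Qed.

Lemma innerNl x y : inner (- x) y = - inner x y.
Proof. by rewrite -scaleN1r innerZl mulN1r. Qed.

Lemma innerNr x y : inner x (- y) = - inner x y.
Proof. by rewrite innerC innerNl rmorphN/= -innerC. Qed.

Lemma innerBl x x' y : inner (x - x') y = inner x y - inner x' y.
Proof. by rewrite innerDl innerNl. Qed.

Lemma innerBr x y y' : inner x (y - y') = inner x y - inner x y'.
Proof. by rewrite innerDr innerNr. Qed.

Lemma inner_suml n (F : 'I_n -> V) y :
  inner (\sum_i F i) y = \sum_i inner (F i) y.
Proof.
by elim/big_ind2: _ => [|u v w z <- <-|//]; rewrite ?inner0l ?innerDl.
Qed.

Lemma inner_sumr n (F : 'I_n -> V) y :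
  inner y (\sum_i F i) = \sum_i inner y (F i).
Proof.
by elim/big_ind2: _ => [|u v w z <- <-|//]; rewrite ?inner0r ?innerDr.
Qed.

Lemma inner_ge0 x : 0 <= inner x x.
Proof.
have [->|x0] := eqVneq x 0; first by rewrite inner0l.
exact/ltW/inner_gt0.
Qed.

Lemma innerxx x : inner x x = (nsq x)%:C.
Proof. by have := ger0_Im (inner_ge0 x); case: (inner x x) => a b /= ->. Qed.

Lemma nsq_ge0 x : 0 <= nsq x.
Proof. by have := inner_ge0 x; rewrite innerxx ler0c. Qed.

Lemma nsq_eq0 x : (nsq x == 0) = (x == 0).
Proof.
apply/eqP/eqP => [|->]; last by rewrite inner0l.
move=> h; apply/eqP; apply: contraTT isT => /inner_gt0.
by rewrite innerxx h ltxx.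
Qed.

Lemma hnorm_sqr x : hnorm x ^+ 2 = nsq x.
Proof. by rewrite sqr_sqrtr// nsq_ge0. Qed.

Lemma inner_ext x y : (forall z, inner x z = inner y z) -> x = y.
Proof.
move=> h; apply/eqP; rewrite -subr_eq0 -nsq_eq0.
by rewrite innerBl h subrr.
Qed.

Lemma Im_inner x y :
  Im (inner x y) = Re (inner x ('i%C *: y)).
Proof. by rewrite innerZr; case: (inner x y) => a b /=; ring. Qed.

Lemma nsqD x y : nsq (x + y) = nsq x + nsq y + 2 * Re (inner x y).
Proof.
rewrite innerDl !innerDr (innerC y x) !raddfD/=.
case: (inner x y) (inner x x) (inner y y) => a b [c d] [e f] /=; lra.
Qed.

Lemma nsqN x : nsq (- x) = nsq x.
Proof. by rewrite innerNl innerNr opprK. Qed.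

Lemma nsqB x y : nsq (x - y) = nsq x + nsq y - 2 * Re (inner x y).
Proof. by rewrite nsqD nsqN innerNr; case: (inner x y) => a b/=; lra. Qed.

Lemma nsqZ a x : nsq (a *: x) = (Re a ^+ 2 + Im a ^+ 2) * nsq x.
Proof.
rewrite innerZl innerZr innerxx; case: a => a b /=; ring.
Qed.

Lemma nsqD_le x y : nsq (x + y) <= 2 * nsq x + 2 * nsq y.
Proof. by have := nsq_ge0 (x - y); rewrite nsqB nsqD; lra. Qed.

Lemma Re_inner_le x y : `|Re (inner x y)| <= nsq x + nsq y.
Proof.
have := nsq_ge0 (x - y); have := nsq_ge0 (x + y); rewrite nsqB nsqD.
have := nsq_ge0 x; have := nsq_ge0 y.
by rewrite ler_norml; lra.
Qed.

Lemma Im_inner_le x y : `|Im (inner x y)| <= nsq x + nsq y.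
Proof.
rewrite Im_inner (le_trans (Re_inner_le _ _))// nsqZ /=.
by rewrite expr0n/= add0r expr1n mul1r.
Qed.

Lemma hnorm_lt x (e : R) : 0 < e -> (hnorm x < e) = (nsq x < e ^+ 2).
Proof.
move=> e0; rewrite -hnorm_sqr ltr_pXn2r// nnegrE ?sqrtr_ge0//.
exact: ltW.
Qed.

Definition span (S : set V) : set V :=
  [set v | exists n (a : 'I_n -> R[i]) (s : 'I_n -> V),
    (forall i, S (s i)) /\ v = \sum_i a i *: s i].

Definition closed_span (S : set V) : set V :=
  [set v | forall e : R, 0 < e -> exists2 w, span S w & hnorm (v - w) < e].

Lemma span0 S : span S 0.
Proof.
exists 0%N, (fun=> 0), (fun=> 0); split; first by case.
by rewrite big_ord0.
Qed.

Lemma spanZ S a x : span S x -> span S (a *: x).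
Proof.
move=> [n [b [s [Ss ->]]]]; exists n, (fun i => a * b i), s; split => //.
by rewrite scaler_sumr; apply: eq_bigr => i _; rewrite scalerA.
Qed.

Lemma spanD S x y : span S x -> span S y -> span S (x + y).
Proof.
move=> [n [b [s [Ss ->]]]] [m [c [t [St ->]]]].
exists (n + m)%N,
  (fun i => match fintype.split i with inl j => b j | inr j => c j end),
  (fun i => match fintype.split i with inl j => s j | inr j => t j end); split.
  by move=> i; case: (fintype.split i).
rewrite big_split_ord/=; congr (_ + _); apply: eq_bigr => i _.
- by rewrite (unsplitK (inl i)).
- by rewrite (unsplitK (inr i)).
Qed.

Lemma closed_span0 S : closed_span S 0.
Proof.
move=> e e0; exists 0; first exact: span0.
by rewrite hnorm_lt// subrr inner0l exprn_gt0.
Qed.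

Lemma closed_spanZ S a x : closed_span S x -> closed_span S (a *: x).
Proof.
move=> Sx e e0.
pose c : R := Re a ^+ 2 + Im a ^+ 2 + 1.
have c0 : 0 < c by rewrite /c ltr_wpDl// addr_ge0 ?sqr_ge0.
have [|w Sw xw] := Sx (Num.sqrt (e ^+ 2 / c)).
  by rewrite sqrtr_gt0 divr_gt0 ?exprn_gt0.
exists (a *: w); first exact: spanZ.
rewrite hnorm_lt// -scalerBr nsqZ.
move: xw; rewrite hnorm_lt ?sqrtr_gt0 ?divr_gt0 ?exprn_gt0//.
rewrite sqr_sqrtr; last by rewrite divr_ge0 ?sqr_ge0// ltW.
rewrite ltr_pdivlMr// mulrC; apply: le_lt_trans.
by rewrite ler_wpM2r ?nsq_ge0// /c lerDl.
Qed.

Lemma closed_spanD S x y :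
  closed_span S x -> closed_span S y -> closed_span S (x + y).
Proof.
move=> Sx Sy e e0; have e20 : 0 < e / 2 by lra.
have [w Sw xw] := Sx _ e20; have [v Sv yv] := Sy _ e20.
exists (w + v); first exact: spanD.
rewrite opprD addrACA hnorm_lt//.
apply: (le_lt_trans (nsqD_le _ _)).
move: xw yv; rewrite !hnorm_lt//; set p := nsq _; set q := nsq _.
by rewrite !expr2; nra.
Qed.

End InnerTheory.

(* An orthonormal basis indexed by nat; eps n is the (n+1)-st vector. *)
Record orthonormal_basis (R : realType) (E : innerType R) := OrthonormalBasis {
  basis_vec :> nat -> E;
  basis_orthonormal : forall m n, inner (basis_vec m) (basis_vec n) = (m == n)%:R;
  basis_total : closed_span (range basis_vec) = setT }.

Section Parseval.
Variables (R : realType) (E : innerType R) (eps : orthonormal_basis E).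
Local Notation nsq x := (Re (inner x x)).

Let p n (x : E) := \sum_(k < n) inner x (eps k) *: eps k.

Let inner_p n x k : (k < n)%N -> inner (x - p n x) (eps k) = 0.
Proof.
move=> kn; rewrite innerBl inner_suml (bigD1 (Ordinal kn))//= big1 => [|i ik].
  by rewrite innerZl basis_orthonormal eqxx mulr1 addr0 subrr.
rewrite innerZl basis_orthonormal; case: eqP => [ij|_]; last by rewrite mulr0.
by move: ik; rewrite -val_eqE/= ij eqxx.
Qed.

Let p_cvg x (e : R) : 0 < e ->
  exists n0, forall n, (n0 <= n)%N -> nsq (x - p n x) < e.
Proof.
move=> e0; have : closed_span (range eps) x by rewrite basis_total.
move=> /(_ (Num.sqrt e)) []; first by rewrite sqrtr_gt0.
move=> w [m [a [s [Ss wE]]]]; rewrite hnorm_lt ?sqrtr_gt0// sqr_sqrtr ?(ltW e0)//.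
move=> xw; have /choice[k ks] : forall i, exists k, eps k = s i.
  by move=> i; have [k _ <-] := Ss i; exists k.
exists (\max_(i < m) (k i)).+1 => n nk; apply: le_lt_trans xw.
have -> : x - w = (x - p n x) + (p n x - w) by rewrite addrA subrK.
rewrite [leRHS]nsqD.
suff -> : inner (x - p n x) (p n x - w) = 0.
  by rewrite /= mulr0 addr0 lerDl nsq_ge0.
rewrite innerBr wE !inner_sumr !big1 ?subr0// => i _.
- rewrite innerZr -(ks i) inner_p ?mulr0//.
  by rewrite (leq_trans _ nk)// ltnS; apply: leq_bigmax.
- by rewrite innerZr inner_p ?mulr0.
Qed.

Lemma parseval_cvg (x y : E) :
  Re (\sum_(k < n) inner x (eps k) * (inner y (eps k))^*%C)
    @[n --> \oo] --> Re (inner x y).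
Proof.
apply/cvgrPdist_lt => e e0.
pose c : R := nsq y + 1.
have c0 : 0 < c by rewrite /c ltr_wpDl// nsq_ge0.
have [|n0 hn0] := @p_cvg x (e ^+ 2 / c); first by rewrite divr_gt0 ?exprn_gt0.
exists n0 => // n /= /hn0 h.
have -> : \sum_(k < n) inner x (eps k) * (inner y (eps k))^*%C = inner (p n x) y.
  rewrite inner_suml; apply: eq_bigr => k _.
  by rewrite innerZl -innerC.
rewrite -raddfB -innerBl; set u := x - p n x in h *.
pose t : R := e / c.
have t0 : 0 < t by rewrite divr_gt0.
have ec : e = t * c by rewrite /t mulfVK// gt_eqF.
have h1 : nsq u < t * e by rewrite (lt_le_trans h)// /t expr2 mulrAC.
have nu := nsq_ge0 u; have ny := nsq_ge0 y.
have := nsq_ge0 (u - t%:C *: y); have := nsq_ge0 (u + t%:C *: y).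
rewrite nsqB nsqD nsqZ innerZr /=.
case: (inner u y) => a b /=.
rewrite oppr0 expr0n/= addr0 mul0r subr0.
have Bc : nsq y <= c by rewrite /c lerDl.
set A := nsq u in h1 nu *; set B := nsq y in ny Bc *.
move=> h2 h3; rewrite ltr_norml.
have tB : t ^+ 2 * B <= t * e.
  by rewrite ec mulrA -expr2 ler_wpM2l ?sqr_ge0.
have hh : A + t ^+ 2 * B < t * (2 * e).
  by rewrite mulrCA mulr_natl mulr2n ltr_leD.
by apply/andP; split; rewrite -subr_gt0 -(pmulr_rgt0 _ t0); lra.
Qed.

End Parseval.

Section ComplexIntegral.
Context d (T : measurableType d) (R : realType).
Variable mu : {measure set T -> \bar R}.
Implicit Types g h : T -> R[i].

Definition cmeasurable g :=
  measurable_fun setT (Re \o g) /\ measurable_fun setT (Im \o g).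

Definition cintegrable g :=
  mu.-integrable setT (EFin \o (Re \o g)) /\
  mu.-integrable setT (EFin \o (Im \o g)).

Definition cintegral g : R[i] :=
  Complex (Rintegral mu setT (Re \o g)) (Rintegral mu setT (Im \o g)).

Lemma cmeasurableD g h :
  cmeasurable g -> cmeasurable h -> cmeasurable (fun t => g t + h t).
Proof.
move=> [gr gi] [hr hi]; split.
- rewrite (_ : _ \o _ = (Re \o g) \+ (Re \o h)).
    exact: measurable_funD.
  by apply/funext => t /=; rewrite raddfD.
- rewrite (_ : _ \o _ = (Im \o g) \+ (Im \o h)).
    exact: measurable_funD.
  by apply/funext => t /=; rewrite raddfD.
Qed.

Lemma cmeasurableM g h :
  cmeasurable g -> cmeasurable h -> cmeasurable (fun t => g t * h t).
Proof.
move=> [gr gi] [hr hi]; split.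
- rewrite (_ : _ \o _ = (Re \o g) \* (Re \o h) \-
    (Im \o g) \* (Im \o h)).
    by apply: measurable_funB; exact: measurable_funM.
  by apply/funext => t /=; case: (g t) (h t) => a b [].
- rewrite (_ : _ \o _ = (Re \o g) \* (Im \o h) \+
    (Im \o g) \* (Re \o h)).
    by apply: measurable_funD; exact: measurable_funM.
  by apply/funext => t /=; case: (g t) (h t) => a b [].
Qed.

Lemma cmeasurable_cst (a : R[i]) : cmeasurable (fun=> a).
Proof. by split; exact: measurable_cst. Qed.

Lemma cmeasurable_conj g : cmeasurable g -> cmeasurable (fun t => (g t)^*%C).
Proof.
move=> [gr gi]; split.
- rewrite (_ : _ \o _ = Re \o g)//.
  by apply/funext => t /=; case: (g t).
- rewrite (_ : _ \o _ = \- (Im \o g)).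
    exact: measurable_funN.
  by apply/funext => t /=; case: (g t).
Qed.

Lemma cmeasurable_sum n (F : 'I_n -> T -> R[i]) :
  (forall i, cmeasurable (F i)) -> cmeasurable (fun t => \sum_i F i t).
Proof.
elim: n F => [|n IHn] F mF.
  under eq_fun do rewrite big_ord0; exact: cmeasurable_cst.
under eq_fun do rewrite big_ord_recl.
by apply: cmeasurableD => //; apply: IHn.
Qed.

Lemma cintegralD g h : cintegrable g -> cintegrable h ->
  cintegral (fun t => g t + h t) = cintegral g + cintegral h.
Proof.
move=> [gr gi] [hr hi]; apply/eqP; rewrite eq_complex; apply/andP; split.
- rewrite /= -RintegralD//; apply/eqP/eq_Rintegral => t _ /=.
  by rewrite raddfD.
- rewrite /= -RintegralD//; apply/eqP/eq_Rintegral => t _ /=.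
  by rewrite raddfD.
Qed.

Lemma cintegralZ (a : R[i]) g : cintegrable g ->
  cintegral (fun t => a * g t) = a * cintegral g.
Proof.
move=> [gr gi]; have scale (r : R) (f : T -> R) :
    mu.-integrable setT (EFin \o f) ->
    mu.-integrable setT (EFin \o (fun t => r * f t)).
  move=> fi; have := integrableZl measurableT r fi.
  by apply: eq_integrable.
apply/eqP; rewrite eq_complex; case: a => a b /=; apply/andP; split; apply/eqP.
- rewrite -!RintegralZl// -RintegralB//; [|exact: scale|exact: scale].
  by apply: eq_Rintegral => t _ /=; case: (g t).
- rewrite -!RintegralZl// -RintegralD//; [|exact: scale|exact: scale].
  by apply: eq_Rintegral => t _ /=; case: (g t).
Qed.

Lemma cintegral_conj g : cintegrable g ->
  cintegral (fun t => (g t)^*%C) = (cintegral g)^*%C.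
Proof.
move=> [gr gi]; apply/eqP; rewrite eq_complex; apply/andP; split; apply/eqP.
- by apply: eq_Rintegral => t _ /=; case: (g t).
- rewrite /= -[RHS]mulN1r -RintegralZl//; apply: eq_Rintegral => t _ /=.
  by case: (g t) => a b /=; rewrite mulN1r.
Qed.

Lemma cintegral_ae g h : cmeasurable g -> cmeasurable h ->
  {ae mu, forall t, g t = h t} -> cintegral g = cintegral h.
Proof.
move=> [gr gi] [hr hi] gh; rewrite /cintegral /Rintegral; congr Complex; congr fine.
- apply: ae_eq_integral => //; [exact/measurable_EFinP|exact/measurable_EFinP|].
  by apply: filterS gh => t /= -> _.
- apply: ae_eq_integral => //; [exact/measurable_EFinP|exact/measurable_EFinP|].
  by apply: filterS gh => t /= -> _.
Qed.

End ComplexIntegral.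

Definition mxintegral d (T : measurableType d) (R : realType)
    (mu : {measure set T -> \bar R}) m n (G : T -> 'M[R[i]]_(m, n)) : 'M[R[i]]_(m, n) :=
  \matrix_(i, j) cintegral mu (fun t => G t i j).

Section DirectIntegral.
Context d (T : measurableType d) (R : realType).
Variables (mu : {measure set T -> \bar R}) (E : innerType R).
Variables (eps : orthonormal_basis E) (N : T -> option nat).
Implicit Types f g : T -> E.

(* E(xi) for N(xi) = n, with [None] for infinity. *)
Definition fiber (n : option nat) : set E :=
  closed_span [set eps k | k in [set k | if n is Some m then (k < m)%N else True]].

(* Weak measurability, which is Borel measurability since E is separable. *)
Definition sqint_field f : Prop :=
  [/\ forall x : E, cmeasurable (fun t => inner (f t) x),
      (\int[mu]_t (hnorm (f t) ^+ 2)%:E < +oo)%E &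
      {ae mu, forall t, fiber (N t) (f t)}].

Lemma cmeasurable_inner f g :
  (forall x, cmeasurable (fun t => inner (f t) x)) ->
  (forall x, cmeasurable (fun t => inner (g t) x)) ->
  cmeasurable (fun t => inner (f t) (g t)).
Proof.
have key f' g' : (forall x, cmeasurable (fun t => inner (f' t) x)) ->
    (forall x, cmeasurable (fun t => inner (g' t) x)) ->
    measurable_fun setT (fun t => Re (inner (f' t) (g' t))).
  move=> mf mg; apply: (@measurable_fun_cvg _ _ _ _ (fun n t =>
      Re (\sum_(k < n) inner (f' t) (eps k) * (inner (g' t) (eps k))^*%C))).
    move=> n; apply: (proj1 (cmeasurable_sum _)) => i.
    by apply: cmeasurableM => //; exact: cmeasurable_conj.
  by move=> t _; exact: parseval_cvg.
move=> mf mg; split; first exact: key.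
rewrite (_ : _ \o _ = (fun t => Re (inner (f t) ('i%C *: g t)))).
  apply: key => // x; under eq_fun do rewrite innerZl.
  by apply: cmeasurableM => //; exact: cmeasurable_cst.
by apply/funext => t /=; rewrite Im_inner.
Qed.

Lemma measurable_hnorm f :
  (forall x, cmeasurable (fun t => inner (f t) x)) ->
  measurable_fun setT (fun t => hnorm (f t) ^+ 2).
Proof.
move=> mf; under eq_fun do rewrite hnorm_sqr.
exact: (proj1 (cmeasurable_inner mf mf)).
Qed.

Lemma integrable_hnorm f : sqint_field f ->
  mu.-integrable setT (fun t => (hnorm (f t) ^+ 2)%:E).
Proof.
move=> [mf intf _]; apply/integrableP; split.
  by apply/measurable_EFinP; exact: measurable_hnorm.
under eq_integral do rewrite gee0_abs ?lee_fin ?sqr_ge0//.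
exact: intf.
Qed.

Lemma cintegrable_inner f g : sqint_field f -> sqint_field g ->
  cintegrable mu (fun t => inner (f t) (g t)).
Proof.
move=> Lf Lg; have [[mf _ _] [mg _ _]] := (Lf, Lg).
have [mr mi] := cmeasurable_inner mf mg.
have ifg := integrableD measurableT (integrable_hnorm Lf) (integrable_hnorm Lg).
split; apply: le_integrable ifg => //; try exact/measurable_EFinP.
- move=> t _ /=; rewrite lee_fin [leRHS]ger0_norm ?addr_ge0 ?sqr_ge0//.
  by rewrite !hnorm_sqr Re_inner_le.
- move=> t _ /=; rewrite lee_fin [leRHS]ger0_norm ?addr_ge0 ?sqr_ge0//.
  by rewrite !hnorm_sqr Im_inner_le.
Qed.

Lemma sqint_field0 : sqint_field 0.
Proof.
split.
- by move=> x; under eq_fun do rewrite /= inner0l; exact: cmeasurable_cst.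
- rewrite integral0_eq// => t _ /=.
  by rewrite hnorm_sqr inner0l.
- by apply: aeW => t; exact: closed_span0.
Qed.

Lemma sqint_fieldD f g :
  sqint_field f -> sqint_field g -> sqint_field (f + g).
Proof.
move=> Lf Lg; have [[mf _ ff] [mg _ fg]] := (Lf, Lg).
have mfg : forall x : E, cmeasurable (fun t => inner ((f + g) t) x).
  by move=> x; under eq_fun do rewrite /= innerDl; exact: cmeasurableD.
split => //; last first.
  by apply: filterS2 ff fg => t; exact: closed_spanD.
have /integrableP[_] := integrableD measurableT
  (integrableZl measurableT 2 (integrable_hnorm Lf))
  (integrableZl measurableT 2 (integrable_hnorm Lg)).
apply: le_lt_trans; apply: ge0_le_integral => //.
- by move=> t _; rewrite lee_fin sqr_ge0.
- by apply/measurable_EFinP; exact: measurable_hnorm.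
- apply: measurableT_comp => //; apply/measurable_EFinP.
  by apply: measurable_funD; apply: measurable_funM => //; exact: measurable_hnorm.
- move=> t _ /=; rewrite lee_fin !hnorm_sqr ger0_norm ?addr_ge0 ?mulr_ge0 ?nsq_ge0//.
  exact: nsqD_le.
Qed.

Lemma sqint_field_mul (phi : T -> R[i]) f : cmeasurable phi ->
  (forall t, `|phi t| <= 1) -> sqint_field f -> sqint_field (fun t => phi t *: f t).
Proof.
move=> mphi phi1 Lf; have [mf intf ff] := Lf.
have mg : forall x : E, cmeasurable (fun t => inner (phi t *: f t) x).
  by move=> x; under eq_fun do rewrite /= innerZl; exact: cmeasurableM.
split => //; last by apply: filterS ff => t; exact: closed_spanZ.
apply: le_lt_trans intf; apply: ge0_le_integral => //.
- by move=> t _; rewrite lee_fin sqr_ge0.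
- by apply/measurable_EFinP; exact: measurable_hnorm.
- by apply/measurable_EFinP; exact: measurable_hnorm.
- move=> t _ /=; rewrite lee_fin !hnorm_sqr nsqZ.
  rewrite -[leRHS]mul1r ler_wpM2r ?nsq_ge0//.
  by rewrite -lecR add_Re2_Im2 exprn_ile1.
Qed.

Lemma sqint_fieldZ (a : R[i]) f : sqint_field f -> sqint_field (a *: f).
Proof.
move=> Lf; have [mf intf ff] := Lf.
have mg : forall x : E, cmeasurable (fun t => inner ((a *: f) t) x).
  move=> x; under eq_fun do rewrite /= innerZl; apply: cmeasurableM => //.
  exact: cmeasurable_cst.
split => //; last by apply: filterS ff => t; exact: closed_spanZ.
under eq_integral do rewrite hnorm_sqr nsqZ -hnorm_sqr EFinM.
rewrite ge0_integralZl//.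
- by rewrite lte_mul_pinfty// lee_fin addr_ge0 ?sqr_ge0.
- by apply/measurable_EFinP; exact: measurable_hnorm.
- by move=> t _; rewrite lee_fin sqr_ge0.
- by rewrite lee_fin addr_ge0 ?sqr_ge0.
Qed.

Definition sqint_pred : {pred T -> E} := mem [set f | sqint_field f].

Lemma sqint_submod_closed : submod_closed sqint_pred.
Proof.
split; first by apply/mem_set; exact: sqint_field0.
move=> a f g /set_mem Lf /set_mem Lg; apply/mem_set.
by apply: sqint_fieldD => //; exact: sqint_fieldZ.
Qed.

HB.instance Definition _ := GRing.isSubmodClosed.Build R[i] (T -> E)
  sqint_pred sqint_submod_closed.

Record sqint_type := SqintField {
  sqint_val :> T -> E;
  sqint_valP : sqint_val \in sqint_pred }.

HB.instance Definition _ := [isSub for sqint_val].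
HB.instance Definition _ := [Choice of sqint_type by <:].
HB.instance Definition _ := [SubChoice_isSubLmodule of sqint_type by <:].

Lemma sqintP (f : sqint_type) : sqint_field f.
Proof. exact: set_mem (sqint_valP f). Qed.

Lemma sqintD (f g : sqint_type) t : (f + g) t = f t + g t.
Proof. by rewrite -[(f + g : sqint_type) t]/(\val (f + g) t) raddfD. Qed.

Lemma sqintN (f : sqint_type) t : (- f) t = - f t.
Proof. by rewrite -[(- f : sqint_type) t]/(\val (- f) t) raddfN. Qed.

Lemma sqintZ a (f : sqint_type) t : (a *: f) t = a *: f t.
Proof. by rewrite -[(a *: f : sqint_type) t]/(\val (a *: f) t) linearZ. Qed.

Lemma sqint0 t : (0 : sqint_type) t = 0.
Proof. by rewrite -[(0 : sqint_type) t]/(\val (0 : sqint_type) t) raddf0. Qed.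

Definition ae_eq_field (f g : sqint_type) : bool :=
  `[< {ae mu, forall t, f t = g t} >].

Let ae_eq_field_refl : reflexive ae_eq_field.
Proof. by move=> f; apply/asboolP; exact: aeW. Qed.

Let ae_eq_field_sym : symmetric ae_eq_field.
Proof.
by move=> f g; apply/asboolP/asboolP; apply: filterS => t ->.
Qed.

Let ae_eq_field_trans : transitive ae_eq_field.
Proof.
move=> f g h /asboolP gf /asboolP fh; apply/asboolP.
by apply: filterS2 gf fh => t -> ->.
Qed.

Canonical ae_eq_field_equiv :=
  EquivRel ae_eq_field ae_eq_field_refl ae_eq_field_sym ae_eq_field_trans.

Local Open Scope quotient_scope.

(* Square-integrable fields modulo almost everywhere equality; [field_of]
   picks a representative. *)
Definition direct_integral : Type := {eq_quot ae_eq_field}.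

HB.instance Definition _ := Choice.on direct_integral.
HB.instance Definition _ := EqQuotient.on direct_integral.

Definition class_of_field (f : sqint_type) : direct_integral := \pi_direct_integral f.
Definition field_of (x : direct_integral) : sqint_type := repr x.
Coercion field_of : direct_integral >-> sqint_type.

Lemma class_of_fieldP (f g : sqint_type) :
  class_of_field f = class_of_field g <-> {ae mu, forall t, f t = g t}.
Proof. by split=> [/eqmodP/asboolP//|h]; apply/eqmodP/asboolP. Qed.

Lemma field_ofK x : class_of_field (field_of x) = x.
Proof. exact: reprK. Qed.

Lemma class_of_fieldK (f : sqint_type) : {ae mu, forall t, field_of (class_of_field f) t = f t}.
Proof. by apply/class_of_fieldP; rewrite field_ofK. Qed.

Lemma dirint_ext (x y : direct_integral) : {ae mu, forall t, x t = y t} -> x = y.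
Proof. by move=> h; rewrite -[x]field_ofK -[y]field_ofK; apply/class_of_fieldP. Qed.

Definition dirint_zero := class_of_field 0.
Definition dirint_add (x y : direct_integral) : direct_integral :=
  class_of_field ((x : sqint_type) + (y : sqint_type)).
Definition dirint_opp (x : direct_integral) : direct_integral :=
  class_of_field (- (x : sqint_type)).
Definition dirint_scale (a : R[i]) (x : direct_integral) : direct_integral :=
  class_of_field (a *: (x : sqint_type)).

Let add_pi (f g : sqint_type) :
  dirint_add (class_of_field f) (class_of_field g) = class_of_field (f + g).
Proof.
apply/class_of_fieldP; apply: filterS2 (class_of_fieldK f) (class_of_fieldK g).
by move=> t fE gE; rewrite !sqintD fE gE.
Qed.

Let opp_pi (f : sqint_type) : dirint_opp (class_of_field f) = class_of_field (- f).
Proof.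
by apply/class_of_fieldP; apply: filterS (class_of_fieldK f) => t fE; rewrite !sqintN fE.
Qed.

Let scale_pi a (f : sqint_type) : dirint_scale a (class_of_field f) = class_of_field (a *: f).
Proof.
by apply/class_of_fieldP; apply: filterS (class_of_fieldK f) => t fE; rewrite !sqintZ fE.
Qed.

Let quotW (P : direct_integral -> Prop) :
  (forall f : sqint_type, P (class_of_field f)) -> forall x, P x.
Proof. by move=> h x; rewrite -[x]field_ofK. Qed.

Let addA : associative dirint_add.
Proof.
by elim/quotW=> f; elim/quotW=> g; elim/quotW=> h; rewrite !add_pi addrA.
Qed.
Let addC : commutative dirint_add.
Proof. by elim/quotW=> f; elim/quotW=> g; rewrite !add_pi addrC. Qed.
Let add0 : left_id dirint_zero dirint_add.
Proof. by elim/quotW=> f; rewrite !add_pi add0r. Qed.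
Let addN : left_inverse dirint_zero dirint_opp dirint_add.
Proof. by elim/quotW=> f; rewrite opp_pi !add_pi addNr. Qed.

HB.instance Definition _ := GRing.isZmodule.Build direct_integral addA addC add0 addN.

Let scaleA a b x : dirint_scale a (dirint_scale b x) = dirint_scale (a * b) x.
Proof. by elim/quotW: x => f; rewrite !scale_pi scalerA. Qed.
Let scale1 : left_id 1 dirint_scale.
Proof. by elim/quotW=> f; rewrite !scale_pi scale1r. Qed.
Let scaleDr : right_distributive dirint_scale +%R.
Proof.
move=> a; elim/quotW=> f; elim/quotW=> g.
rewrite [class_of_field f + _]add_pi !scale_pi scalerDr.
exact/esym/add_pi.
Qed.
Let scaleDl x : {morph dirint_scale^~ x : a b / a + b}.
Proof. elim/quotW: x => f a b; rewrite !scale_pi scalerDl.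
exact/esym/add_pi. Qed.

HB.instance Definition _ := GRing.Zmodule_isLmodule.Build R[i] direct_integral
  scaleA scale1 scaleDr scaleDl.

Lemma dirint_addE (x y : direct_integral) : {ae mu, forall t, field_of (x + y) t = x t + y t}.
Proof. by apply: filterS (class_of_fieldK (field_of x + field_of y)) => t ->; rewrite sqintD. Qed.

Lemma dirint_scaleE a (x : direct_integral) : {ae mu, forall t, field_of (a *: x) t = a *: x t}.
Proof. by apply: filterS (class_of_fieldK (a *: field_of x)) => t ->; rewrite sqintZ. Qed.

Lemma dirint_zeroE : {ae mu, forall t, field_of 0 t = 0}.
Proof. by apply: filterS (class_of_fieldK 0) => t ->; rewrite sqint0. Qed.

Definition dirint_inner (x y : direct_integral) : R[i] :=
  cintegral mu (fun t => inner (x t) (y t)).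

Let cint (x y : direct_integral) : cintegrable mu (fun t => inner (x t) (y t)).
Proof. by apply: cintegrable_inner; exact: sqintP. Qed.

Let cmeas (x y : direct_integral) : cmeasurable (fun t => inner (x t) (y t)).
Proof.
by have [[mx _ _] [my _ _]] := (sqintP x, sqintP y); exact: cmeasurable_inner.
Qed.

Let dirint_inner_linear a (x x' y : direct_integral) :
  dirint_inner (a *: x + x') y = a * dirint_inner x y + dirint_inner x' y.
Proof.
rewrite /dirint_inner -cintegralZ// -cintegralD//; last first.
  have [mx ix fx] := sqintP x.
  have := @cintegrable_inner (a *: (x : sqint_type)) y (sqintP _) (sqintP _).
  by under [X in cintegrable mu X]eq_fun do rewrite innerZl.
apply: cintegral_ae => //.
  apply: cmeasurableD => //; apply: cmeasurableM => //; exact: cmeasurable_cst.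
apply: filterS2 (dirint_addE (a *: x) x') (dirint_scaleE a x) => t -> ->.
by rewrite innerDl innerZl.
Qed.

Let dirint_innerC (x y : direct_integral) :
  dirint_inner x y = (dirint_inner y x)^*%C.
Proof.
rewrite /dirint_inner -cintegral_conj//; congr cintegral.
by apply/funext => t; rewrite -innerC.
Qed.

Let dirint_inner_gt0 (x : direct_integral) : x != 0 -> 0 < dirint_inner x x.
Proof.
move=> x0; rewrite /dirint_inner.
have -> : cintegral mu (fun t => inner (x t) (x t)) =
    (Rintegral mu setT (fun t => hnorm (x t) ^+ 2))%:C.
  rewrite /cintegral; congr Complex.
    by apply: eq_Rintegral => t _ /=; rewrite hnorm_sqr.
  rewrite -[RHS](Rintegral_set0 mu (fun=> 0)) /Rintegral integral_set0.
  rewrite (@eq_integral _ _ _ _ _ (cst 0%E)) ?integral0// => t _ /=.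
  by rewrite innerxx.
rewrite -[0]/((0:R)%:C) ltcR /Rintegral.
have mh : measurable_fun setT (fun t => (hnorm (x t) ^+ 2)%:E).
  by have [mx _ _] := sqintP x; apply/measurable_EFinP; exact: measurable_hnorm.
have h0 t : (0 <= (hnorm (x t) ^+ 2)%:E)%E by rewrite lee_fin sqr_ge0.
rewrite fine_gt0//; apply/andP; split; last by have [_] := sqintP x.
rewrite lt_neqAle integral_ge0// andbT eq_sym; apply: contra x0 => /eqP i0.
apply/eqP/dirint_ext.
have /(ae_eq_integral_abs mu measurableT mh) h : (\int[mu]_t `|(hnorm (x t) ^+ 2)%:E| = 0)%E.
  by under eq_integral do rewrite gee0_abs//.
apply: filterS2 h dirint_zeroE => t /= /(_ I) [ht] ->.
by apply/eqP; rewrite -nsq_eq0 -hnorm_sqr ht.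
Qed.

HB.instance Definition _ := Lmodule_isInner.Build R direct_integral
  dirint_inner_linear dirint_innerC dirint_inner_gt0.

End DirectIntegral.

Section Euclidean.
Variables (R : realType) (d : nat).
Implicit Types x y : 'cV[R[i]]_d.

Definition cV_inner x y : R[i] := \sum_i x i 0 * (y i 0)^*%C.

Let cV_inner_linear a x x' y :
  cV_inner (a *: x + x') y = a * cV_inner x y + cV_inner x' y.
Proof.
rewrite /cV_inner mulr_sumr -big_split/=; apply: eq_bigr => i _.
by rewrite !mxE mulrDl mulrA.
Qed.

Let cV_innerC x y : cV_inner x y = (cV_inner y x)^*%C.
Proof.
rewrite /cV_inner rmorph_sum/=; apply: eq_bigr => i _.
by rewrite rmorphM/= conjcK mulrC.
Qed.

Let cV_inner_gt0 x : x != 0 -> 0 < cV_inner x x.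
Proof.
move=> x0; have h i : 0 <= x i 0 * (x i 0)^*%C by exact: mulcJ_ge0.
rewrite lt_neqAle sumr_ge0// andbT eq_sym; apply: contra x0.
rewrite psumr_eq0// => /allP h0; apply/eqP/matrixP => i j.
rewrite (ord1 j) mxE; apply/eqP.
have /= := h0 i (mem_index_enum _).
by rewrite mulf_eq0 conjc_eq0 orbb.
Qed.

HB.instance Definition _ := Lmodule_isInner.Build R 'cV[R[i]]_d
  cV_inner_linear cV_innerC cV_inner_gt0.

End Euclidean.

Section ComplexSeries.
Variable R : realType.
Implicit Types u v : nat -> R[i].

Definition csummable u :=
  cvgn (series (fun n => Re (u n))) /\ cvgn (series (fun n => Im (u n))).

Definition csum u : R[i] :=
  Complex (limn (series (fun n => Re (u n)))) (limn (series (fun n => Im (u n)))).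

Lemma csumD u v : csummable u -> csummable v ->
  csum (fun n => u n + v n) = csum u + csum v.
Proof.
move=> [ur ui] [vr vi]; apply/eqP; rewrite eq_complex /=; apply/andP; split.
- rewrite -lim_seriesD//; apply/eqP; congr (limn (series _)).
  by apply/funext => n; rewrite raddfD.
- rewrite -lim_seriesD//; apply/eqP; congr (limn (series _)).
  by apply/funext => n; rewrite raddfD.
Qed.

Lemma csumZ (a : R[i]) u : csummable u -> csum (fun n => a * u n) = a * csum u.
Proof.
move=> [ur ui].
have scale (r : R) (f : nat -> R) : cvgn (series f) ->
    cvgn (series (fun n => r * f n)).
  exact: is_cvg_seriesZ.
have scaleE (r : R) (f : nat -> R) : cvgn (series f) ->
    limn (series (fun n => r * f n)) = r * limn (series f).
  exact: lim_seriesZ.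
apply/eqP; rewrite eq_complex; case: a => a b /=; apply/andP; split; apply/eqP.
- rewrite -!scaleE// -lim_seriesB//; try exact: scale.
  by congr (limn (series _)); apply/funext => n; rewrite ?fctE; case: (u n).
- rewrite -!scaleE// -lim_seriesD//; try exact: scale.
  by congr (limn (series _)); apply/funext => n; rewrite ?fctE; case: (u n).
Qed.

Lemma csum_conj u : csummable u -> csum (fun n => (u n)^*%C) = (csum u)^*%C.
Proof.
move=> [ur ui]; apply/eqP; rewrite eq_complex /=; apply/andP; split; apply/eqP.
- by congr (limn (series _)); apply/funext => n; rewrite ?fctE; case: (u n).
- rewrite -lim_seriesN//; congr (limn (series _)); apply/funext => n.
  by rewrite ?fctE; case: (u n).
Qed.

End ComplexSeries.

(* H^2(C^d): the function z |-> \sum_n a_n z^n is represented by its Taylor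
   coefficients (a_n), and its norm is that of (a_n) in l^2. *)
Section HardySpace.
Variables (R : realType) (d : nat).
Implicit Types a b : nat -> 'cV[R[i]]_d.

Definition square_summable a := cvgn (series (fun n => hnorm (a n) ^+ 2)).

Lemma square_summable0 : square_summable 0.
Proof.
rewrite /square_summable (_ : series _ = cst 0); first exact: is_cvg_cst.
by apply/funext => n; rewrite /series/= big1// => k _; rewrite hnorm_sqr inner0l.
Qed.

Lemma square_summableD a b :
  square_summable a -> square_summable b -> square_summable (a + b).
Proof.
move=> sa sb; apply: (@series_le_cvg _ _
    (fun n => 2 * hnorm (a n) ^+ 2 + 2 * hnorm (b n) ^+ 2)).
- by move=> n /=; rewrite sqr_ge0.
- by move=> n /=; rewrite !hnorm_sqr addr_ge0 ?mulr_ge0 ?nsq_ge0.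
- by move=> n /=; rewrite !hnorm_sqr; exact: nsqD_le.
- by apply: is_cvg_seriesD; exact: is_cvg_seriesZ.
Qed.

Lemma square_summableZ (c : R[i]) a : square_summable a -> square_summable (c *: a).
Proof.
move=> sa; rewrite /square_summable (_ : (fun n => _) =
    (fun n => (Re c ^+ 2 + Im c ^+ 2) * hnorm (a n) ^+ 2)).
  exact: is_cvg_seriesZ.
by apply/funext => n; rewrite !hnorm_sqr nsqZ.
Qed.

Definition hardy_pred : {pred nat -> 'cV[R[i]]_d} := mem [set a | square_summable a].

Lemma hardy_submod_closed : submod_closed hardy_pred.
Proof.
split; first by apply/mem_set; exact: square_summable0.
move=> c a b /set_mem sa /set_mem sb; apply/mem_set.
by apply: square_summableD => //; exact: square_summableZ.
Qed.

HB.instance Definition _ := GRing.isSubmodClosed.Build R[i] (nat -> 'cV[R[i]]_d)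
  hardy_pred hardy_submod_closed.

Record hardy := Hardy {
  taylor :> nat -> 'cV[R[i]]_d;
  taylorP : taylor \in hardy_pred }.

HB.instance Definition _ := [isSub for taylor].
HB.instance Definition _ := [Choice of hardy by <:].
HB.instance Definition _ := [SubChoice_isSubLmodule of hardy by <:].

Implicit Types f g : hardy.

Definition heval f (z : R[i]) : 'cV[R[i]]_d :=
  \col_i csum (fun n => f n i 0 * z ^+ n).

Definition hardy_inner f g : R[i] := csum (fun n => inner (f n) (g n)).

Lemma csummable_inner f g : csummable (fun n => inner (f n) (g n)).
Proof.
have sf : square_summable f := set_mem (taylorP f).
have sg : square_summable g := set_mem (taylorP g).
have sfg := is_cvg_seriesD sf sg.
split; apply: normed_cvg; apply: series_le_cvg sfg => n //=; rewrite fctE.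
- by rewrite addr_ge0 ?sqr_ge0.
- by rewrite !hnorm_sqr Re_inner_le.
- by rewrite addr_ge0 ?sqr_ge0.
- by rewrite !hnorm_sqr Im_inner_le.
Qed.

Let hardyD f g n : (f + g : hardy) n = f n + g n.
Proof. by rewrite -[(f + g : hardy) n]/(\val (f + g) n) raddfD. Qed.

Let hardyZ c f n : (c *: f : hardy) n = c *: f n.
Proof. by rewrite -[(c *: f : hardy) n]/(\val (c *: f) n) linearZ. Qed.

Let hardy_inner_linear c f f' g :
  hardy_inner (c *: f + f') g = c * hardy_inner f g + hardy_inner f' g.
Proof.
rewrite /hardy_inner -csumZ; last exact: csummable_inner.
rewrite -csumD; last exact: csummable_inner.
  by congr csum; apply/funext => n; rewrite hardyD hardyZ innerDl innerZl.
have := csummable_inner (c *: f) g.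
by under [X in csummable X]eq_fun do rewrite hardyZ innerZl.
Qed.

Let hardy_innerC f g : hardy_inner f g = (hardy_inner g f)^*%C.
Proof.
rewrite /hardy_inner -csum_conj; last exact: csummable_inner.
by congr csum; apply/funext => n; rewrite -innerC.
Qed.

Let hardy_inner_gt0 f : f != 0 -> 0 < hardy_inner f f.
Proof.
move=> f0.
have [n fn0] : exists n, f n != 0.
  apply: contrapT => /forallNP h; move/eqP: f0; apply; apply/val_inj/funext => n.
  by rewrite /= -[RHS]/(\val (0 : hardy) n) raddf0; apply/eqP/negPn/negP/h.
have -> : hardy_inner f f = (limn (series (fun k => hnorm (f k) ^+ 2)))%:C.
  rewrite /hardy_inner /csum; congr Complex.
    by congr (limn (series _)); apply/funext => k; rewrite hnorm_sqr.
  rewrite (_ : series _ = cst 0) ?lim_cst//.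
  by apply/funext => k; rewrite /series/= big1// => j _; rewrite innerxx.
rewrite -[0]/((0:R)%:C) ltcR.
have sf : square_summable f := set_mem (taylorP f).
apply: (@lt_le_trans _ _ (series (fun k => hnorm (f k) ^+ 2) n.+1)).
  rewrite /series/= big_nat_recr//= ltr_wpDl ?sumr_ge0 // => [k _|].
    by rewrite sqr_ge0.
  rewrite hnorm_sqr lt_neqAle nsq_ge0 andbT eq_sym.
  by rewrite nsq_eq0.
apply: nondecreasing_cvgn_le => //.
by apply: nondecreasing_series => k _ _; rewrite sqr_ge0.
Qed.

HB.instance Definition _ := Lmodule_isInner.Build R hardy
  hardy_inner_linear hardy_innerC hardy_inner_gt0.

Definition shift_seq a (n : nat) : 'cV[R[i]]_d := if n is m.+1 then a m else 0.

Let shift_subproof f : shift_seq f \in hardy_pred.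
Proof.
have sf : square_summable f := set_mem (taylorP f).
apply/mem_set; rewrite /square_summable/=.
apply/cvg_ex; exists (limn (series (fun k => hnorm (f k) ^+ 2))).
rewrite -cvg_shiftS.
rewrite (_ : (fun n => _) = series (fun k => hnorm (f k) ^+ 2))//.
apply/funext => n; rewrite /series/= big_nat_recl//=.
by rewrite hnorm_sqr inner0l add0r.
Qed.

Definition hardy_mulz f : hardy := Hardy (shift_subproof f).

Let csummable_heval f (z : R[i]) i : `|z| < 1 ->
  csummable (fun n => f n i 0 * z ^+ n).
Proof.
move=> z1; have sf : square_summable f := set_mem (taylorP f).
pose q : R := Re z ^+ 2 + Im z ^+ 2.
have q0 : 0 <= q by rewrite addr_ge0 ?sqr_ge0.
have q1 : q < 1.
  by rewrite -ltcR add_Re2_Im2 exprn_ilt1.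
have sq : cvgn (series (fun n => q ^+ n)).
  have := @is_cvg_geometric_series R 1 q; rewrite ger0_norm// => /(_ q1).
  rewrite (_ : geometric 1 q = (fun n => q ^+ n))//.
  by apply/funext => n; rewrite /geometric/= mul1r.
have s2 := is_cvg_seriesD sf sq.
have zq n : Re (z ^+ n) ^+ 2 + Im (z ^+ n) ^+ 2 = q ^+ n.
  apply: (@complexI R); rewrite add_Re2_Im2 normrX exprAC -add_Re2_Im2.
  by rewrite rmorphXn.
have fi n : Re (f n i 0) ^+ 2 + Im (f n i 0) ^+ 2 <= hnorm (f n) ^+ 2.
  rewrite hnorm_sqr /inner/= /cV_inner raddf_sum/= (bigD1 i)//=.
  rewrite (_ : Re (f n i 0 * _) = Re (f n i 0) ^+ 2 + Im (f n i 0) ^+ 2).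
    rewrite lerDl sumr_ge0// => k _; case: (f n k 0) => a b /=.
    by rewrite mulrN opprK addr_ge0// -expr2 sqr_ge0.
  by case: (f n i 0) => a b /=; ring.
split; apply: normed_cvg; apply: series_le_cvg s2 => n //=; rewrite fctE.
- by rewrite addr_ge0 ?sqr_ge0 ?exprn_ge0.
- move: (fi n) (zq n); case: (f n i 0) (z ^+ n) => a b [c e] /= h <-.
  apply: le_trans (lerD h (lexx _)).
  have := (sqr_ge0 (a - c), sqr_ge0 (a + c), sqr_ge0 (b - e), sqr_ge0 (b + e)).
  by rewrite !expr2 ler_norml => -[[[? ?] ?] ?]; lra.
- by rewrite addr_ge0 ?sqr_ge0 ?exprn_ge0.
- move: (fi n) (zq n); case: (f n i 0) (z ^+ n) => a b [c e] /= h <-.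
  apply: le_trans (lerD h (lexx _)).
  have := (sqr_ge0 (a - e), sqr_ge0 (a + e), sqr_ge0 (b - c), sqr_ge0 (b + c)).
  by rewrite !expr2 ler_norml => -[[[? ?] ?] ?]; lra.
Qed.

Lemma heval_mulz f (z : R[i]) : `|z| < 1 -> heval (hardy_mulz f) z = z *: heval f z.
Proof.
move=> z1; apply/matrixP => i j; rewrite !mxE.
have sh (u : nat -> R) (v : nat -> R) : cvgn (series v) -> u 0%N = 0 ->
    (forall n, u n.+1 = v n) -> limn (series u) = limn (series v).
  move=> sv u0 uv; apply/cvg_lim => //; rewrite -cvg_shiftS.
  rewrite (_ : (fun n => _) = series v)//; apply/funext => n.
  by rewrite /series/= big_nat_recl//= u0 add0r; apply: eq_bigr => k _.
have [sr si] := csummable_heval f i z1.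
have ReM (x y : R[i]) : Re (x * y) = Re x * Re y - Im x * Im y.
  by case: x y => a b [].
have ImM (x y : R[i]) : Im (x * y) = Re x * Im y + Im x * Re y.
  by case: x y => a b [].
rewrite -csumZ; last exact: csummable_heval.
have [tr ti] : csummable (fun n => z * (f n i 0 * z ^+ n)).
  split.
  - rewrite (_ : (fun n => _) = (fun n => Re z * Re (f n i 0 * z ^+ n)) -
        (fun n => Im z * Im (f n i 0 * z ^+ n))).
      by apply: is_cvg_seriesB; exact: is_cvg_seriesZ.
    by apply/funext => n; rewrite !fctE [LHS]ReM.
  - rewrite (_ : (fun n => _) = (fun n => Re z * Im (f n i 0 * z ^+ n)) +
        (fun n => Im z * Re (f n i 0 * z ^+ n))).
      by apply: is_cvg_seriesD; exact: is_cvg_seriesZ.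
    by apply/funext => n; rewrite !fctE [LHS]ImM.
by congr Complex; apply: sh => //= [|n]; rewrite ?mxE ?mul0r// exprS mulrCA.
Qed.

End HardySpace.

Section ModelSpace.
Variables (R : realType) (d : nat) (theta : R[i] -> 'M[R[i]]_d).

Definition theta_hardy : set (hardy R d) :=
  [set h | exists g : hardy R d,
     forall z : R[i], `|z| < 1 -> heval h z = theta z *m heval g z].

Definition model_pred : {pred hardy R d} :=
  mem [set f : hardy R d | forall h, theta_hardy h -> inner f h = 0].

Lemma model_submod_closed : submod_closed model_pred.
Proof.
split; first by apply/mem_set => h _; rewrite inner0l.
move=> a f g /set_mem Kf /set_mem Kg; apply/mem_set => h th.
by rewrite innerDl innerZl Kf// Kg// mulr0 addr0.
Qed.

HB.instance Definition _ := GRing.isSubmodClosed.Build R[i] (hardy R d)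
  model_pred model_submod_closed.

(* K_theta, the orthogonal complement of theta H^2(C^d) in H^2(C^d) *)
Record model_space := ModelSpace {
  model_val :> hardy R d;
  model_valP : model_val \in model_pred }.

HB.instance Definition _ := [isSub for model_val].
HB.instance Definition _ := [Choice of model_space by <:].
HB.instance Definition _ := [SubChoice_isSubLmodule of model_space by <:].

Definition model_inner (f g : model_space) : R[i] := inner (\val f) (\val g).

Let model_inner_linear a f f' g :
  model_inner (a *: f + f') g = a * model_inner f g + model_inner f' g.
Proof. by rewrite /model_inner linearP/= innerDl innerZl. Qed.

Let model_innerC f g : model_inner f g = (model_inner g f)^*%C.
Proof. exact: innerC. Qed.

Let model_inner_gt0 f : f != 0 -> 0 < model_inner f f.
Proof.
move=> f0; apply: inner_gt0; apply: contra f0 => /eqP f0.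
by apply/eqP/val_inj; rewrite f0 raddf0.
Qed.

HB.instance Definition _ := Lmodule_isInner.Build R model_space
  model_inner_linear model_innerC model_inner_gt0.

Definition is_model_proj (P : hardy R d -> model_space) : Prop :=
  forall (f : hardy R d) (g : model_space), inner (f - P f) (g : hardy R d) = 0.

End ModelSpace.

Section Operators.
Variable R : realType.

(* In each [xget] below at most one function has the stated property; the
   value is 0 if none has it. *)
Definition adjoint (V W : innerType R) (A : V -> W) : W -> V :=
  xget (fun=> 0) [set A' : W -> V | forall x y, inner (A x) y = inner x (A' y)].

Lemma adjointE (V W : innerType R) (A : V -> W) (A' : W -> V) :
  (forall x y, inner (A x) y = inner x (A' y)) -> adjoint A = A'.
Proof.
move=> h; apply: xget_subset1 => // A1 A2 h1 h2; apply/funext => y.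
by apply: inner_ext => z; rewrite innerC -h1 h2 -innerC.
Qed.

Definition op_inv (V : innerType R) (A : V -> V) : V -> V :=
  xget (fun=> 0) [set A' : V -> V | cancel A A' /\ cancel A' A].

Lemma op_invE (V : innerType R) (A A' : V -> V) :
  cancel A A' -> cancel A' A -> op_inv A = A'.
Proof.
move=> AA' A'A; apply: xget_subset1 => // A1 A2 [A1l A1r] [A2l A2r].
by apply/funext => x; rewrite -{1}(A2r x) A1l.
Qed.

Definition op_sqrt (V : innerType R) (A : V -> V) : V -> V :=
  xget (fun=> 0) [set D : V -> V |
    [/\ linear D, forall x, 0 <= inner (D x) x & forall x, D (D x) = A x]].

Definition defect (V : innerType R) (A : V -> V) : V -> V :=
  op_sqrt (fun x => x - adjoint A (A x)).

Definition op_zpow (V : innerType R) (U : V -> V) (k : int) : V -> V :=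
  match k with Posz n => iter n U | Negz n => iter n.+1 (op_inv U) end.

Definition star_cyclic (V : innerType R) (U : V -> V) (S : set V) : Prop :=
  closed_span [set y | exists (k : int) x, S x /\ y = op_zpow U k x] = setT.

Definition isometric (V W : innerType R) (A : V -> W) : Prop :=
  forall x, hnorm (A x) = hnorm x.

Definition unitary (V W : innerType R) (A : V -> W) : Prop :=
  [/\ linear A, isometric A & forall y, exists x, A x = y].

Section Perturbation.
Variables (V : innerType R) (d : nat) (U : V -> V) (B : 'cV[R[i]]_d -> V).

Definition T0 : V -> V := fun f => U f - B (adjoint B (U f)).

Definition theta0 (z : R[i]) : 'M[R[i]]_d :=
  let T := T0 in let Ts := adjoint T0 in
  \matrix_(i, j)
    let w := adjoint U (B (delta_mx j 0)) in
    adjoint B (- T w +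
      z *: defect Ts (op_inv (fun f => f - z *: Ts f) (defect T w))) i 0.

End Perturbation.

(* Radial boundary values at e^{it} exist and are isometries for Lebesgue
   almost every t. *)
Definition inner_function (d : nat) (theta : R[i] -> 'M[R[i]]_d) : Prop :=
  {ae (@lebesgue_measure R), forall t : R, exists2 M : 'M[R[i]]_d,
    forall i j,
      Re (theta (r%:C * Complex (cos t) (sin t)) i j) @[r --> 1^'-] --> Re (M i j) /\
      Im (theta (r%:C * Complex (cos t) (sin t)) i j) @[r --> 1^'-] --> Im (M i j) &
    (map_mx (@conjc R) M)^T *m M = 1%:M}.

(* [P] is the orthogonal projection onto K_theta, so that
   [fun f => P (hardy_mulz f)] is the model operator. *)
Record clark_operator (V : innerType R) (d : nat) (U : V -> V)
    (B : 'cV[R[i]]_d -> V) (P : hardy R d -> model_space (theta0 U B))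
    (Phi : model_space (theta0 U B) -> V) : Prop := ClarkOperator {
  clark_unitary : unitary Phi;
  clark_intertwining : forall f : model_space (theta0 U B),
    Phi (P (hardy_mulz f)) = T0 U B (Phi f);
  clark_B : forall (e : 'cV[R[i]]_d) (z : R[i]), `|z| < 1 ->
    heval (adjoint Phi (B e)) z = e;
  clark_UB : forall (e : 'cV[R[i]]_d) (z : R[i]), `|z| < 1 -> z != 0 ->
    heval (adjoint Phi (adjoint U (B e))) z = z^-1 *: (theta0 U B z *m e) }.

End Operators.

Section Circle.
Variable R : realType.

Definition circle := {z : R[i] | `|z| == 1}.

Lemma circle1_subproof : `|1 : R[i]| == 1.
Proof. by rewrite normr1. Qed.

HB.instance Definition _ := Choice.on circle.
HB.instance Definition _ := isPointed.Build circle
  (exist _ 1 circle1_subproof : circle).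

Definition circle_open : set (set circle) :=
  [set A | exists2 O : set R[i]^o, open O & A = [set xi | O (sval xi)]].

Definition borel_circle := g_sigma_algebraType circle_open.

HB.instance Definition _ := Measurable.on borel_circle.

Definition cval (xi : borel_circle) : R[i] := sval (xi : circle).

Lemma norm_cval xi : `|cval xi| = 1.
Proof. exact/eqP/(svalP (xi : circle)). Qed.

Let measurable_cval_part (p : R[i]^o -> R) : continuous p ->
  measurable_fun setT (fun xi : borel_circle => p (cval xi)).
Proof.
move=> cp; apply: (measurability (@RGenOpens.G R)).
  exact: RGenOpens.measurableE.
move=> _ [_ [a [b ->]] <-]; rewrite setTI; apply: sub_sigma_algebra.
exists (p @^-1` `]a, b[%classic) => //.
by apply: open_comp => //; exact: interval_open.
Qed.

Let norm_part (z : R[i]) (e : R) : `|z| < e%:C -> `|Re z| < e /\ `|Im z| < e.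
Proof.
rewrite normc_def ltcR => h; split; apply: le_lt_trans h.
- by rewrite -sqrtr_sqr ler_wsqrtr// lerDl sqr_ge0.
- by rewrite -sqrtr_sqr ler_wsqrtr// lerDr sqr_ge0.
Qed.

Let near_norm (z : R[i]^o) (e : R) : 0 < e ->
  \forall w \near z, `|Re (z - w)| < e /\ `|Im (z - w)| < e.
Proof.
move=> e0; apply/nbhs_ballP; exists e%:C; first by rewrite /= -[0]/((0:R)%:C) ltcR.
by move=> w; rewrite -ball_normE => /norm_part.
Qed.

Let continuous_Re : continuous (Re : R[i]^o -> R).
Proof.
move=> z; apply/(@cvgrPdist_lt _ _ R[i]^o (nbhs (z : R[i]^o)) _ ) => e e0.
by apply: filterS (near_norm z e0) => w [h _]; rewrite -raddfB.
Qed.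

Let continuous_Im : continuous (Im : R[i]^o -> R).
Proof.
move=> z; apply/(@cvgrPdist_lt _ _ R[i]^o (nbhs (z : R[i]^o)) _ ) => e e0.
by apply: filterS (near_norm z e0) => w [_ h]; rewrite -raddfB.
Qed.

Lemma cmeasurable_cval : cmeasurable cval.
Proof. by split; exact: measurable_cval_part. Qed.

End Circle.

Section MultiplicationOperator.
Context (R : realType) (mu : {measure set (borel_circle R) -> \bar R}).
Context (E : innerType R) (eps : orthonormal_basis E).
Context (N : borel_circle R -> option nat).
Local Notation H := (direct_integral mu eps N).

Let mulxi_subproof (f : H) : (fun xi => cval xi *: f xi) \in sqint_pred mu eps N.
Proof.
apply/mem_set; apply: sqint_field_mul; last exact: sqintP.
- exact: cmeasurable_cval.
- by move=> t; rewrite norm_cval.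
Qed.

Definition mulxi (f : H) : H := class_of_field (SqintField (mulxi_subproof f)).

Lemma mulxiE (f : H) : {ae mu, forall xi, field_of (mulxi f) xi = cval xi *: f xi}.
Proof. exact: class_of_fieldK. Qed.

Section Coordinates.
Variables (d : nat) (B : 'cV[R[i]]_d -> H).

(* B(xi) : C^d -> E has columns b_k(xi), where b_k = B e_k. *)
Definition B_at (xi : borel_circle R) (e : 'cV[R[i]]_d) : E :=
  \sum_k e k 0 *: field_of (B (delta_mx k 0)) xi.

Definition Bstar_at (xi : borel_circle R) : E -> 'cV[R[i]]_d := adjoint (B_at xi).

Definition BstarB_at (xi : borel_circle R) : 'M[R[i]]_d :=
  \matrix_(i, j) Bstar_at xi (B_at xi (delta_mx j 0)) i 0.

Definition F_matrix (z : R[i]) : 'M[R[i]]_d :=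
  mxintegral mu (fun xi => (1 - z * (cval xi)^*%C)^-1 *: BstarB_at xi).

End Coordinates.
End MultiplicationOperator.

(* Main.v *)
Require Import Defs.
From HB Require Import structures.
From mathcomp Require Import all_boot all_order all_algebra.
From mathcomp Require Import complex.
From mathcomp Require Import all_classical all_reals all_analysis measurable_realfun.

Set Implicit Arguments.
Unset Strict Implicit.
Unset Printing Implicit Defensive.

Import Order.TTheory GRing.Theory Num.Theory.
Import numFieldNormedType.Exports.

Local Open Scope classical_set_scope.
Local Open Scope ring_scope.

(** Write [J] for the adjoint of the Clark operator [Phi], [Bs] for the adjoint
    of [B], and [Ua] for the adjoint of [U], multiplication by the conjugate of
    the variable. The whole theorem follows from one identity,

      J(g - z Ua g)(z) = (I - theta(z)) Bs g,      |z| < 1,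

    which is [clark_resolvent]. The operator [I - z Ua] on the direct integral
    is multiplication by [1 - conj(xi) z], so [g] can be taken to be
    [f(xi) / (1 - conj(xi) z)] ([resolvent_exists]); then the left side is
    [J f(z)] and [Bs g] is the Cauchy integral in the theorem
    ([cauchy_transformE]). For [f = B e] the Cauchy integral is [F(z) e] and
    [J f] is the constant [e], so [(I - theta(z)) F(z) = I]; hence [F(z)] is
    invertible with inverse [I - theta(z)].

    The identity comes from reading the intertwining relation through adjoints.
    The adjoint of the model operator is the backward shift
    [h |-> (h - h(0)) / z], and the adjoint of [T_0] is [Ua - Ua B Bs], so

      J (Ua g - Ua B Bs g) = (J g - (J g)(0)) / z      ([clark_backshift]).

    It remains to insert [J Ua B e = theta e / z] and [(J g)(0) = Bs g]. The
    last equation holds because evaluation at 0 is the inner product with the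
    constants, and the constant [e] is [J B e] ([clark_eval0]). Passing to
    adjoints keeps the projection onto the model space implicit: the backward
    shift leaves the model space invariant, whereas the model operator itself
    would require the defect [z h - P (z h)]. *)

Local Notation Re := (@complex.Re _).
Local Notation Im := (@complex.Im _).

(** * Adjoints of isometries and of operators on C^d *)

Section Adjoints.
Variable R : realType.

(** Polarization; the imaginary part of an inner product is the real part
    against [i *: y]. *)
Lemma isometric_inner (V W : innerType R) (A : V -> W) :
  linear A -> isometric A -> forall x y, inner (A x) (A y) = inner x y.
Proof.
move=> linA isoA.
have AD x y : A (x + y) = A x + A y by rewrite -[x in LHS]scale1r linA scale1r.
have A0 : A 0 = 0 by apply: (addrI (A 0)); rewrite -AD !addr0.
have AZ a x : A (a *: x) = a *: A x by rewrite -[a *: x]addr0 linA A0 addr0.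
have nsqA x : Re (inner (A x) (A x)) = Re (inner x x).
  by rewrite -!hnorm_sqr isoA.
have ReA x y : Re (inner (A x) (A y)) = Re (inner x y).
  have := nsqA (x + y); rewrite AD !nsqD !nsqA => /addrI.
  by apply: mulfI; rewrite pnatr_eq0.
by move=> x y; apply/eqP; rewrite eq_complex !Im_inner -AZ !ReA !eqxx.
Qed.

Lemma linear_adjoint (V W : innerType R) (A : V -> W) (A' : W -> V) :
  (forall x y, inner (A x) y = inner x (A' y)) -> linear A'.
Proof.
move=> AA' a x y; apply: inner_ext => z.
by rewrite innerC -AA' innerDr innerZr !AA' -innerZr -innerDr -innerC.
Qed.

(** The adjoint is the inverse, so it exists and is itself isometric. In
    particular [adjoint A] is not the default value of its definition. *)
Lemma unitary_adjoint (V W : innerType R) (A : V -> W) : unitary A ->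
  (forall x y, inner (A x) y = inner x (adjoint A y)) /\
  (forall x y, inner (adjoint A x) (adjoint A y) = inner x y).
Proof.
move=> [linA isoA surjA]; have [A' A'K] := choice surjA.
have adjA x y : inner (A x) y = inner x (A' y).
  by rewrite -[y in LHS]A'K isometric_inner.
by rewrite (adjointE adjA); split=> // x y; rewrite -adjA A'K.
Qed.

Lemma inner_delta n (x : 'cV[R[i]]_n) i : inner x (delta_mx i 0) = x i 0.
Proof.
rewrite /inner/= /cV_inner (bigD1 i)//= big1 => [|j ji].
  by rewrite mxE !eqxx conjc1 mulr1 addr0.
by rewrite mxE (negbTE ji) conjc0 mulr0.
Qed.

(** Used both for [B] and for its pointwise values [B(xi)]; the operator is
    written through its columns because [B_at] is defined in this form. *)
Lemma adjoint_sum_basis (V : innerType R) n (v : 'I_n -> V) :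
  adjoint (fun e : 'cV[R[i]]_n => \sum_k e k 0 *: v k) =
  fun y => \col_k inner y (v k).
Proof.
apply: adjointE => e y; rewrite inner_suml [RHS]/inner/= /cV_inner.
by apply: eq_bigr => k _; rewrite innerZl mxE -innerC.
Qed.

Lemma linear_sum_basis (V : innerType R) n (A : {linear 'cV[R[i]]_n -> V}) :
  A = (fun e => \sum_k e k 0 *: A (delta_mx k 0)) :> (_ -> _).
Proof.
apply/funext => e; rewrite -[LHS]/(A e).
have {1}-> : e = \sum_k e k 0 *: delta_mx k 0.
  apply/matrixP => i j; rewrite ord1 summxE (bigD1 i)//= big1 => [|k ki].
    by rewrite !mxE !eqxx mulr1 addr0.
  by rewrite !mxE eq_sym (negbTE ki) mulr0.
by rewrite linear_sum; apply: eq_bigr => k _; rewrite linearZ.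
Qed.

Lemma adjoint_linearE (V : innerType R) n (A : {linear 'cV[R[i]]_n -> V}) :
  adjoint A = fun y => \col_k inner y (A (delta_mx k 0)).
Proof. by rewrite [in LHS]linear_sum_basis adjoint_sum_basis. Qed.

Lemma adjoint_linearP (V : innerType R) n (A : {linear 'cV[R[i]]_n -> V}) e y :
  inner (A e) y = inner e (adjoint A y).
Proof.
rewrite adjoint_linearE [in LHS]linear_sum_basis inner_suml [RHS]/inner/= /cV_inner.
by apply: eq_bigr => k _; rewrite innerZl mxE -innerC.
Qed.

End Adjoints.

(** * Evaluation and the backward shift on the Hardy space *)

Section Hardy.
Variable R : realType.

Lemma csum_recl (u : nat -> R[i]) : csummable (fun n => u n.+1) ->
  csum u = u 0%N + csum (fun n => u n.+1).
Proof.
have recl (v : nat -> R) : cvgn (series (fun n => v n.+1)) ->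
    limn (series v) = v 0%N + limn (series (fun n => v n.+1)).
  move=> cv; apply/cvg_lim => //; rewrite -cvg_shiftS.
  rewrite (_ : (fun n => _) = (fun n => v 0%N + series (fun k => v k.+1) n)).
    by apply: cvgD => //; exact: cvg_cst.
  by apply/funext => n; rewrite /series/= big_nat_recl.
move=> [ur ui]; rewrite /csum (recl _ ur) (recl _ ui).
by case: (u 0%N).
Qed.

Lemma csum_fst (u : nat -> R[i]) : (forall n, u n.+1 = 0) -> csum u = u 0%N.
Proof.
move=> u0; have s0 : series (fun=> 0 : R) = cst 0.
  by apply/funext => n; rewrite /series/= big1.
have cu : csummable (fun n => u n.+1).
  by split; under eq_fun do rewrite u0; rewrite s0; exact: is_cvg_cst.
rewrite csum_recl// /csum; under [X in series X]eq_fun do rewrite u0.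
under [X in Complex _ (limn (series X))]eq_fun do rewrite u0.
by rewrite s0 lim_cst// addr0.
Qed.

Variable d : nat.
Implicit Types f g : hardy R d.

Lemma hardyB f g n : (f - g) n = f n - g n.
Proof. by rewrite -[(f - g) n]/(\val (f - g) n) raddfB. Qed.

Lemma backshift_subproof f : (fun n => f n.+1) \in @hardy_pred R d.
Proof.
have sf : square_summable f := set_mem (taylorP f).
apply/mem_set; rewrite /square_summable/=; apply/cvg_ex.
exists (limn (series (fun k => hnorm (f k) ^+ 2)) - hnorm (f 0%N) ^+ 2).
rewrite (_ : series _ =
  (fun n => series (fun k => hnorm (f k) ^+ 2) n.+1 - hnorm (f 0%N) ^+ 2)).
  by apply: cvgB; [rewrite cvg_shiftS|exact: cvg_cst].
by apply/funext => n; rewrite /series/= big_nat_recl// addrAC subrr add0r.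
Qed.

Definition backshift f : hardy R d := Hardy (backshift_subproof f).

Lemma inner_mulz f g : inner (hardy_mulz f) g = inner f (backshift g).
Proof.
rewrite /inner/= /hardy_inner csum_recl/=; last exact: (csummable_inner f (backshift g)).
by rewrite inner0l add0r.
Qed.

Lemma szego_subproof (z : R[i]) (i : 'I_d) : `|z| < 1 ->
  (fun n => ((z^*)%C ^+ n) *: delta_mx i 0) \in @hardy_pred R d.
Proof.
move=> z1; pose q : R := Re z ^+ 2 + Im z ^+ 2.
have q0 : 0 <= q by rewrite addr_ge0 ?sqr_ge0.
have q1 : q < 1 by rewrite -ltcR add_Re2_Im2 exprn_ilt1.
apply/mem_set; rewrite /square_summable/= (_ : (fun n => _) = geometric 1 q).
  by apply: is_cvg_geometric_series; rewrite ger0_norm.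
apply/funext => n; rewrite hnorm_sqr nsqZ inner_delta mxE !eqxx mulr1 /= mul1r.
apply: (@complexI R); rewrite add_Re2_Im2 normrX exprAC normcJ -add_Re2_Im2.
by rewrite rmorphXn.
Qed.

(** The Szego kernel [w |-> (1 - conj z w)^-1 e_i]. Since it lies in the Hardy
    space, evaluation at [z] is an inner product, and its linearity and the
    summability behind it are those of the inner product. *)
Definition szego (z : R[i]) (z1 : `|z| < 1) i : hardy R d := Hardy (szego_subproof i z1).

Lemma inner_szego f z (z1 : `|z| < 1) i : inner f (szego z1 i) = heval f z i 0.
Proof.
rewrite mxE /inner/= /hardy_inner; congr csum; apply/funext => n /=.
by rewrite innerZr inner_delta rmorphXn/= conjcK mulrC.
Qed.

Lemma heval_linear z : `|z| < 1 -> linear (fun f : hardy R d => heval f z).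
Proof.
move=> z1 a f g; apply/matrixP => i j; rewrite ord1 !mxE.
have := inner_szego (a *: f + g) z1 i.
by rewrite innerDl innerZl !inner_szego !mxE.
Qed.

Lemma heval0 f : heval f 0 = f 0%N.
Proof.
apply/matrixP => i j; rewrite ord1 mxE csum_fst ?mulr1// => n.
by rewrite expr0n mulr0.
Qed.

Lemma heval_backshift f z : `|z| < 1 ->
  z *: heval (backshift f) z = heval f z - heval f 0.
Proof.
move=> z1; rewrite -heval_mulz//.
suff <- : heval (f - hardy_mulz (backshift f)) z = heval f 0.
  have := heval_linear z1 1 (f - hardy_mulz (backshift f)) (hardy_mulz (backshift f)).
  by rewrite /= !scale1r subrK => ->; rewrite addrAC subrr add0r.
apply/matrixP => i j; rewrite heval0 ord1 mxE csum_fst => [|n].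
  by rewrite hardyB/= subr0 mulr1.
by rewrite hardyB/= subrr mxE mul0r.
Qed.

Lemma inner_szego0 (z1 : `|0 : R[i]| < 1) (i : 'I_d) : inner (szego z1 i) (szego z1 i) = 1.
Proof. by rewrite inner_szego heval0/= expr0 scale1r mxE !eqxx. Qed.

(** The adjoint of multiplication by [z] maps the complement of [theta H^2] to
    itself because [theta H^2] is stable under multiplication by [z]. *)
Lemma backshift_model (theta : R[i] -> 'M[R[i]]_d) (f : model_space theta) :
  backshift f \in model_pred theta.
Proof.
apply/mem_set => h [g hg]; rewrite innerC -inner_mulz -innerC.
apply: (set_mem (model_valP f)); exists (hardy_mulz g) => z z1.
by rewrite !heval_mulz// hg// scalemxAr.
Qed.

End Hardy.

(** * The adjoint of the Clark operator *)

Section Clark.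
Variables (R : realType) (V : innerType R) (d : nat).
Variables (U Ua : V -> V) (B : {linear 'cV[R[i]]_d -> V}).
Hypothesis UaP : forall x y, inner (U x) y = inner x (Ua y).
Hypothesis B_isometric : isometric B.

Lemma isometric_adjointK e : adjoint B (B e) = e.
Proof.
apply: inner_ext => x; rewrite innerC -adjoint_linearP -innerC.
by apply: isometric_inner => // a u v; exact: linearP.
Qed.

Lemma adjoint_coord y i : adjoint B y i 0 = inner y (B (delta_mx i 0)).
Proof. by rewrite adjoint_linearE mxE. Qed.

(** The second summand of [theta] carries a factor [z], and [Bs T = 0] since
    [T = (I - B Bs) U] and [Bs B = I]. *)
Lemma theta0_0 : theta0 U B 0 = 0.
Proof.
apply/matrixP => i j; rewrite !mxE; cbv zeta; rewrite scale0r addr0 adjoint_coord.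
rewrite /T0 innerNl innerBl adjoint_linearP isometric_adjointK inner_delta.
by rewrite adjoint_coord subrr oppr0.
Qed.

Variables (P : hardy R d -> model_space (theta0 U B)).
Variables (Phi : model_space (theta0 U B) -> V).
Hypothesis P_proj : is_model_proj P.
Hypothesis clark : clark_operator P Phi.

Local Notation J := (adjoint Phi).

(** Pointwise, [J B e_i] is the constant [e_i]. To get equality in the Hardy
    space without uniqueness of power series: both vectors have norm 1, and
    their inner product is the value of [J B e_i] at 0, which is 1. *)
Lemma clark_adjoint_B i (z1 : `|0 : R[i]| < 1) :
  model_val (J (B (delta_mx i 0))) = szego z1 i.
Proof.
have [_ JJ] := unitary_adjoint (clark_unitary clark).
set g := J _.
have g1 : inner (model_val g) (model_val g) = 1.
  rewrite -[LHS]/(inner g g) JJ isometric_inner//; last by move=> a u v; exact: linearP.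
  by rewrite inner_delta mxE !eqxx.
have gk : inner (model_val g) (szego z1 i) = 1.
  by rewrite inner_szego (clark_B clark)// mxE !eqxx.
apply/eqP; rewrite -subr_eq0 -nsq_eq0 innerBl !innerBr g1 gk inner_szego0.
by rewrite (innerC (szego z1 i)) gk conjc1 !subrr.
Qed.

Lemma clark_eval0 f : heval (J f) 0 = adjoint B f.
Proof.
have z1 : `|0 : R[i]| < 1 by rewrite normr0.
have [_ JJ] := unitary_adjoint (clark_unitary clark).
apply/matrixP => i j; rewrite ord1 -(inner_szego _ z1) -clark_adjoint_B.
by rewrite -[LHS]/(inner (J f) (J _)) JJ adjoint_linearE mxE.
Qed.

(** The adjoint form of [Phi M = T_0 Phi]: against [g] in the model space, both
    sides equal [inner (z g) (J f)]. The projection [P] disappears because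
    [J f] already lies in the model space. *)
Lemma clark_backshift f :
  model_val (J (Ua (f - B (adjoint B f)))) = backshift (J f).
Proof.
have [PhiJ _] := unitary_adjoint (clark_unitary clark).
pose S := ModelSpace (backshift_model (J f)).
suff -> : J (Ua (f - B (adjoint B f))) = S by [].
apply: inner_ext => g; rewrite innerC [RHS]innerC; congr (_^*%C).
rewrite -[RHS]inner_mulz -PhiJ -UaP.
have -> : inner (hardy_mulz g) (model_val (J f)) = inner (P (hardy_mulz g)) (J f).
  by apply/eqP; rewrite -subr_eq0 -[X in _ - X]/(inner (model_val _) (model_val _))
     -innerBl P_proj.
rewrite -PhiJ (clark_intertwining clark) /T0 innerBl innerBr; congr (_ - _).
by rewrite adjoint_linearP innerC adjoint_linearP -innerC.
Qed.

(** Multiply [clark_backshift] by [z] and insert the known values of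
    [J Ua B e]. The point [z = 0], where that value is not prescribed, follows
    from [theta(0) = 0] and [clark_eval0]. *)
Lemma clark_resolvent g z : `|z| < 1 ->
  heval (J (g - z *: Ua g)) z = (1%:M - theta0 U B z) *m adjoint B g.
Proof.
move=> z1; have [PhiJ _] := unitary_adjoint (clark_unitary clark).
have linJ : linear J := linear_adjoint PhiJ.
have linUa : linear Ua := linear_adjoint UaP.
have evalJ a x y : heval (J (a *: x + y)) z = a *: heval (J x) z + heval (J y) z.
  by rewrite linJ -[model_val _]/(\val _) linearP heval_linear.
rewrite mulmxBl mul1mx addrC -scaleNr evalJ.
have [->|z0] := eqVneq z 0.
  by rewrite theta0_0 mul0mx subr0 oppr0 scale0r add0r clark_eval0.
have := heval_backshift (J g) z1; rewrite -clark_backshift clark_eval0.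
have evalUB e : heval (J (Ua (B e))) z = z^-1 *: (theta0 U B z *m e).
  by rewrite -(adjointE UaP) (clark_UB clark).
rewrite -[g - _]addrC -scaleN1r linUa evalJ evalUB.
rewrite scalerDr scaleN1r scalerN scalerA mulfV// scale1r => /eqP.
rewrite addrC subr_eq => /eqP h.
by rewrite scaleNr h !opprD opprK addrAC [- _ + _]addrC subrK.
Qed.

End Clark.

(** * Multiplication operators and the Cauchy transform on the direct integral *)

Lemma cmeasurable_inv (R : realType) d (T : measurableType d) (g : T -> R[i]) :
  cmeasurable g -> cmeasurable (fun t => (g t)^-1).
Proof.
move=> [gr gi].
pose n2 t := Re (g t) ^+ 2 + Im (g t) ^+ 2.
have mn : measurable_fun setT (fun t => (n2 t)^-1).
  (* x^-1 as a real power, whose measurability is known. *)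
  under eq_fun do rewrite -powR_inv1 ?addr_ge0 ?sqr_ge0//.
  apply: (measurableT_comp (measurable_powR _)).
  by apply: measurable_funD; exact: measurable_funX.
split.
- rewrite (_ : _ \o _ = (Re \o g) \* (fun t => (n2 t)^-1)).
    exact: measurable_funM.
  by apply/funext => t; rewrite /n2/=; case: (g t).
- rewrite (_ : _ \o _ = \- ((Im \o g) \* (fun t => (n2 t)^-1))).
    by apply: measurable_funN; exact: measurable_funM.
  by apply/funext => t; rewrite /n2/=; case: (g t).
Qed.

Section Multiplication.
Context (R : realType) (mu : {measure set (borel_circle R) -> \bar R}).
Context (E : innerType R) (eps : orthonormal_basis E).
Context (N : borel_circle R -> option nat).
Local Notation H := (direct_integral mu eps N).

(** Contractive multipliers preserve square-integrable fields; a multiplier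
    bounded by [c] is rescaled to a contractive one. *)
Lemma dirint_mul (phi : borel_circle R -> R[i]) (c : R[i]) : cmeasurable phi ->
  0 < c -> (forall xi, `|phi xi| <= c) ->
  forall f : H, exists g : H, {ae mu, forall xi, g xi = phi xi *: f xi}.
Proof.
move=> mphi c0 phic f.
have Lg : (fun xi => (c^-1 * phi xi) *: f xi) \in sqint_pred mu eps N.
  apply/mem_set; apply: sqint_field_mul; last exact: sqintP.
    by apply: cmeasurableM => //; exact: cmeasurable_cst.
  by move=> xi; rewrite normrM normfV (gtr0_norm c0) mulrC ler_pdivrMr// mul1r.
exists (c *: class_of_field (SqintField Lg)).
apply: filterS2 (class_of_fieldK (SqintField Lg))
  (dirint_scaleE c (class_of_field (SqintField Lg))) => xi gE -> .
by rewrite gE/= scalerA mulrA mulfV ?mul1r// gt_eqF.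
Qed.

Lemma cmeasurable_dirint_inner (f g : H) : cmeasurable (fun xi => inner (f xi) (g xi)).
Proof.
by have [[mf _ _] [mg _ _]] := (sqintP f, sqintP g); exact: cmeasurable_inner.
Qed.

Lemma mulxi_conj_adjoint (f g h : H) :
  {ae mu, forall xi, h xi = (cval xi)^*%C *: g xi} ->
  inner (mulxi f) g = inner f h.
Proof.
move=> hE; apply: cintegral_ae; try exact: cmeasurable_dirint_inner.
by apply: filterS2 hE (mulxiE f) => xi -> ->; rewrite innerZl innerZr conjcK.
Qed.

Lemma norm_cauchy_le (xi : borel_circle R) z : `|z| < 1 ->
  `|(1 - (cval xi)^*%C * z)^-1| <= (1 - `|z|)^-1.
Proof.
move=> z1; have p : 0 < 1 - `|z| by rewrite subr_gt0.
have le : 1 - `|z| <= `|1 - (cval xi)^*%C * z|.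
  have := lerB_dist 1 ((cval xi)^*%C * z).
  by rewrite normr1 normrM normcJ norm_cval mul1r.
by rewrite normfV lef_pV2// posrE (lt_le_trans p).
Qed.

Lemma cauchy_neq0 (xi : borel_circle R) z : `|z| < 1 -> 1 - (cval xi)^*%C * z != 0.
Proof.
move=> z1; rewrite subr_eq0; apply: contraTneq z1 => /(congr1 Num.norm).
by rewrite normr1 normrM normcJ norm_cval mul1r => <-; rewrite ltxx.
Qed.

Lemma cmeasurable_cauchy z :
  cmeasurable (fun xi : borel_circle R => (1 - (cval xi)^*%C * z)^-1).
Proof.
apply: cmeasurable_inv; apply: cmeasurableD; first exact: cmeasurable_cst.
under eq_fun do rewrite -mulrN.
apply: cmeasurableM; last exact: cmeasurable_cst.
exact/cmeasurable_conj/cmeasurable_cval.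
Qed.

Lemma Bstar_atE d (B : 'cV[R[i]]_d -> H) xi y :
  Bstar_at B xi y = \col_k inner y (field_of (B (delta_mx k 0)) xi).
Proof. exact: (congr1 (fun A => A y) (adjoint_sum_basis _)). Qed.

Lemma B_at_delta d (B : 'cV[R[i]]_d -> H) xi j :
  B_at B xi (delta_mx j 0) = field_of (B (delta_mx j 0)) xi.
Proof.
rewrite /B_at (bigD1 j)//= big1 => [|k kj].
  by rewrite mxE !eqxx scale1r addr0.
by rewrite mxE (negbTE kj) scale0r.
Qed.

Definition cauchy_transform d (B : 'cV[R[i]]_d -> H) (f : H) z : 'cV[R[i]]_d :=
  mxintegral mu (fun xi => (1 - (cval xi)^*%C * z)^-1 *: Bstar_at B xi (field_of f xi)).

(** Each coordinate of the Cauchy integral is the inner product of the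
    resolvent field [g] with a column [B e_i]. *)
Lemma cauchy_transformE d (B : {linear 'cV[R[i]]_d -> H}) (f g : H) z :
  {ae mu, forall xi, g xi = (1 - (cval xi)^*%C * z)^-1 *: f xi} ->
  cauchy_transform B f z = adjoint B g.
Proof.
move=> gE; apply/matrixP => i j; rewrite ord1 adjoint_coord mxE.
under [in LHS]eq_fun do rewrite mxE Bstar_atE mxE.
apply: cintegral_ae; try exact: cmeasurable_dirint_inner.
  apply: cmeasurableM; first exact: cmeasurable_cauchy.
  exact: cmeasurable_dirint_inner.
by apply: filterS gE => xi ->; rewrite innerZl.
Qed.

Lemma col_F_matrix d (B : {linear 'cV[R[i]]_d -> H}) z j :
  F_matrix B z *m delta_mx j 0 = cauchy_transform B (B (delta_mx j 0)) z.
Proof.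
rewrite -colE; apply/matrixP => i k; rewrite !mxE; congr cintegral.
by apply/funext => xi; rewrite !mxE B_at_delta [z * _]mulrC (ord1 k).
Qed.

(** Solves [(I - z Ua) g = f] on the direct integral by pointwise division. *)
Lemma resolvent_exists (Ua : H -> H) z :
  (forall f, {ae mu, forall xi, Ua f xi = (cval xi)^*%C *: f xi}) -> `|z| < 1 ->
  forall f : H, exists2 g : H,
    {ae mu, forall xi, g xi = (1 - (cval xi)^*%C * z)^-1 *: f xi} &
    g - z *: Ua g = f.
Proof.
move=> UaE z1 f.
have c0 : 0 < (1 - `|z|)^-1 by rewrite invr_gt0 subr_gt0.
have [g gE] := dirint_mul (cmeasurable_cauchy z) c0 (fun xi => norm_cauchy_le xi z1) f.
exists g => //; apply: dirint_ext; rewrite addrC -scaleNr.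
near=> xi.
have -> : field_of (- z *: Ua g + g) xi = field_of (- z *: Ua g) xi + field_of g xi.
  by near: xi; exact: dirint_addE.
have -> : field_of (- z *: Ua g) xi = - z *: field_of (Ua g) xi.
  by near: xi; exact: dirint_scaleE.
have -> : field_of (Ua g) xi = (cval xi)^*%C *: field_of g xi.
  by near: xi; exact: UaE.
have -> : field_of g xi = (1 - (cval xi)^*%C * z)^-1 *: field_of f xi.
  by near: xi; exact: gE.
rewrite !scalerA -scalerDl mulNr [z * _]mulrC -mulNr -[X in _ + X]mul1r -mulrDl.
by rewrite addrC mulNr mulfV ?scale1r// cauchy_neq0.
Unshelve. all: by end_near.
Qed.

End Multiplication.

Theorem corollary8p8 (R : realType)
    (mu : {finite_measure set (borel_circle R) -> \bar R})
    (E : hilbertType R) (eps : orthonormal_basis E)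
    (N : borel_circle R -> option nat)
    (N_measurable : forall n : option nat, measurable (N @^-1` [set n]))
    (d : nat) (B : {linear 'cV[R[i]]_d -> direct_integral mu eps N})
    (B_isometric : isometric B) :
  let U : direct_integral mu eps N -> direct_integral mu eps N :=
    @mulxi R mu E eps N in
  star_cyclic U (range B) ->
  let theta := theta0 U B in
  inner_function theta ->
  forall P : hardy R d -> model_space theta, is_model_proj P ->
  forall Phi : model_space theta -> direct_integral mu eps N,
  clark_operator P Phi ->
  forall (f : direct_integral mu eps N) (z : R[i]), `|z| < 1 ->
  let I := mxintegral mu (fun xi : borel_circle R =>
    (1 - (cval xi)^*%C * z)^-1 *: Bstar_at B xi (field_of f xi)) in
  [/\ heval (adjoint Phi f) z = (1%:M - theta z) *m I,
      F_matrix B z \in unitmx &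
      heval (adjoint Phi f) z = invmx (F_matrix B z) *m I].
Proof.
move=> U _ theta _ P P_proj Phi clark f z z1 I.
have norm_conj xi : `|(cval xi)^*%C : R[i]| <= 1 by rewrite normcJ norm_cval.
have [Ua UaE] := choice (@dirint_mul R mu E eps N _ 1
  (cmeasurable_conj (cmeasurable_cval R)) ltr01 norm_conj).
have UaP x y : inner (U x) y = inner x (Ua y) by exact: mulxi_conj_adjoint.
have clark_cauchy h :
    heval (adjoint Phi h) z = (1%:M - theta z) *m cauchy_transform B h z.
  have [g gE gh] := resolvent_exists UaE z1 h.
  rewrite (cauchy_transformE B gE) -{1}gh.
  exact: (clark_resolvent UaP B_isometric P_proj clark g z1).
have thetaF : (1%:M - theta z) *m F_matrix B z = 1%:M.
  apply/matrixP => i j.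
  have /matrixP/(_ i 0) : (1%:M - theta z) *m F_matrix B z *m delta_mx j 0 =
      delta_mx j 0 :> 'cV_d.
    by rewrite -mulmxA col_F_matrix -clark_cauchy (clark_B clark).
  by rewrite -colE !mxE eqxx andbT.
have [_ unitF] := mulmx1_unit thetaF.
have -> : invmx (F_matrix B z) = 1%:M - theta z.
  by rewrite -[RHS](mulmxK unitF) thetaF mul1mx.
by split=> //; exact: clark_cauchy.
Qed.
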